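(* Let $(X,\{\})$ be a generalized heap, and let $(XX^{-1},X^{-1}X,X,\langle-,-\rangle,[-,-])$ be the equivalence bimodule constructed from it. Then the generalized heap constructed from this equivalence bimodule, namely the set $X$ with the ternary operation $(x,y,z)\mapsto\langle x,y\rangle\cdot z$, is equal to $(X,\{\})$; that is, $\langle x,y\rangle\cdot z=\{xyz\}$ for all $x,y,z\in X$.
   Context: Generalized heap: a set $X$ with a (total) ternary operation $(x,y,z)\mapsto\{xyz\}$ satisfying, for all elements: (A1) $\{xxx\}=x$; (A2) $\{\{x_1x_2x_3\}x_4x_5\}=\{x_1\{x_4x_3x_2\}x_5\}=\{x_1x_2\{x_3x_4x_5\}\}$; (A3) $\{xx\{yyz\}\}=\{yy\{xxz\}\}$; (A4) $\{\{zxx\}yy\}=\{\{zyy\}xx\}$. Modules: for an inverse semigroup $S$, a left $S$-module is a set $X$ with a map $S\times X\to X$, $(s,x)\mapsto sx$, such that $(st)x=s(tx)$ and which is unitary: $SX=X$. Right modules are defined dually. An $(S,T)$-bimodule is a left $S$-module and right $T$-module $X$ with $(sx)t=s(xt)$ for all $s\in S$, $t\in T$, $x\in X$. Equivalence bimodule: for inverse semigroups $S,T$, an equivalence bimodule $(S,T,X,\langle-,-\rangle,[-,-])$ is an $(S,T)$-bimodule $X$ with surjective functions $\langle-,-\rangle\colon X\times X\to S$ and $[-,-]\colon X\times X\to T$ such that for all $x,y,z\in X$, $s\in S$, $t\in T$: $\langle sx,y\rangle=s\langle x,y\rangle$; $\langle y,x\rangle=\langle x,y\rangle^{-1}$; $\langle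 x,x\rangle x=x$; $[x,yt]=[x,y]t$; $[x,y]=[y,x]^{-1}$; $x[x,x]=x$; $\langle x,y\rangle z=x[y,z]$. The generalized heap constructed from an equivalence bimodule is the set $X$ with the ternary operation $(x,y,z)\mapsto\langle x,y\rangle z$. Equivalence bimodule constructed from a generalized heap $(X,\{\})$: put $x\circ y=\{xxy\}$ and $x\bullet y=\{xyy\}$. Then $(X,\circ)$ is a right normal band and $(X,\bullet)$ is a left normal band. Green's relation $\mathcal R$ on $(X,\circ)$ and Green's relation $\mathcal L$ on $(X,\bullet)$ are semilattice congruences; $p\colon X\to E=(X,\circ)/\mathcal R$ and $q\colon X\to F=(X,\bullet)/\mathcal L$ are the natural maps. Thus $p(x)=p(y)$ iff $x=\{yyx\}$ and $y=\{xxy\}$; $q(x)=q(y)$ iff $x=\{xyy\}$ and $y=\{yxx\}$. The inverse semigroup $X^{-1}X$: on the set of pairs $(x,y)\in X\times X$ with $p(x)=p(y)$ put $(x,y)\equiv(u,v)$ iff $q(x)=q(u)$, $q(y)=q(v)$ and $y=\{xuv\}$; this is an equivalence relation. Write $x^{-1}y$ for the class of $(x,y)$ and $X^{-1}X$ for the set of classes, with multiplication $x^{-1}y\otimes u^{-1}v=\{\{yuu\}yx\}^{-1}\{yuv\}$. The inverse semigroup $XX^{-1}$: on the set of pairs $(x,y)$ with $q(x)=q(y)$ put $(x,y)\equiv(u,v)$ iff $p(x)=p(u)$, $p(y)=p(v)$ and $x=\{uvy\}$; this is an equivalence relation. Write $xy^{-1}$ for the class of $(x,y)$ and $XX^{-1}$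 for the set of classes, with multiplication $xy^{-1}\otimes uv^{-1}=\{xyu\}\{vu\{yyu\}\}^{-1}$. The actions are $xy^{-1}\cdot z=\{xyz\}$ and $x\cdot y^{-1}z=\{xyz\}$, and $\langle x,y\rangle=\{xyy\}\{yxx\}^{-1}$, $[x,y]=\{yyx\}^{-1}\{xxy\}$. These data form an equivalence bimodule. *)

(* Defs.v *)
From Corelib Require Import ssreflect ssrfun ssrbool.
From Stdlib Require Import FunctionalExtensionality PropExtensionality.
From Stdlib Require Import ProofIrrelevance IndefiniteDescription.

Set Implicit Arguments.
Unset Strict Implicit.
Unset Printing Implicit Defensive.

(** * Generalized heaps

    [h x y z] is {xyz}. *)

Record gheap (X : Type) := GHeap {
  heap_op :> X -> X -> X -> X;
  heap_A1 : forall x, heap_op x x x = x;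
  heap_A2l : forall x1 x2 x3 x4 x5,
    heap_op (heap_op x1 x2 x3) x4 x5 = heap_op x1 (heap_op x4 x3 x2) x5;
  heap_A2r : forall x1 x2 x3 x4 x5,
    heap_op x1 (heap_op x4 x3 x2) x5 = heap_op x1 x2 (heap_op x3 x4 x5);
  heap_A3 : forall x y z,
    heap_op x x (heap_op y y z) = heap_op y y (heap_op x x z);
  heap_A4 : forall x y z,
    heap_op (heap_op z x x) y y = heap_op (heap_op z y y) x x }.

(** * Inverse semigroups, modules, equivalence bimodules *)

Record inverse_semigroup := InverseSemigroup {
  isg_car :> Type;
  isg_mul : isg_car -> isg_car -> isg_car;
  isg_inv : isg_car -> isg_car;
  isg_assoc : forall r s t, isg_mul r (isg_mul s t) = isg_mul (isg_mul r s) t;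
  isg_invK : forall s, isg_mul (isg_mul s (isg_inv s)) s = s;
  isg_invV : forall s, isg_mul (isg_mul (isg_inv s) s) (isg_inv s) = isg_inv s;
  isg_uniq : forall s t, isg_mul (isg_mul s t) s = s ->
    isg_mul (isg_mul t s) t = t -> t = isg_inv s }.

Record left_module (S : inverse_semigroup) (X : Type) := LeftModule {
  lact : S -> X -> X;
  lactM : forall s t x, lact (isg_mul s t) x = lact s (lact t x);
  lact_unitary : forall x, exists s y, lact s y = x }.

Record right_module (T : inverse_semigroup) (X : Type) := RightModule {
  ract : X -> T -> X;
  ractM : forall s t x, ract x (isg_mul s t) = ract (ract x s) t;
  ract_unitary : forall x, exists y t, ract y t = x }.

Record bimodule (S T : inverse_semigroup) (X : Type) := Bimodule {
  bim_left :> left_module S X;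
  bim_right :> right_module T X;
  bim_comm : forall s x t,
    ract bim_right (lact bim_left s x) t = lact bim_left s (ract bim_right x t) }.

Record equivalence_bimodule (S T : inverse_semigroup) (X : Type) :=
  EquivalenceBimodule {
  eb_bim :> bimodule S T X;
  lform : X -> X -> S;
  rform : X -> X -> T;
  lform_surj : forall s, exists x y, lform x y = s;
  rform_surj : forall t, exists x y, rform x y = t;
  lformM : forall s x y, lform (lact eb_bim s x) y = isg_mul s (lform x y);
  lformV : forall x y, lform y x = isg_inv (lform x y);
  lform_id : forall x, lact eb_bim (lform x x) x = x;
  rformM : forall x y t, rform x (ract eb_bim y t) = isg_mul (rform x y) t;
  rformV : forall x y, rform x y = isg_inv (rform y x);
  rform_id : forall x, ract eb_bim x (rform x x) = x;
  form_assoc : forall x y z,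
    lact eb_bim (lform x y) z = ract eb_bim x (rform y z) }.

(** * The generalized heap constructed from an equivalence bimodule *)

Section InverseSemigroupTheory.
Context (S : inverse_semigroup).
Local Notation "x * y" := (@isg_mul S x y).
Local Notation "x ^-1" := (@isg_inv S x) (at level 3, format "x ^-1").

Lemma isg_idem_inv (e : S) : e * e = e -> e^-1 = e.
Proof. by move=> ee; rewrite -(@isg_uniq S e e) // !ee. Qed.

Lemma isg_idem_mul (e f : S) : e * e = e -> f * f = f ->
  (e * f) * (e * f) = e * f.
Proof.
move=> ee ff; set g := (e * f)^-1.
have K : e * f * g * (e * f) = e * f by apply: isg_invK.
have V : g * (e * f) * g = g by apply: isg_invV.
have fge : f * g * e = g.
  apply: isg_uniq; first by
    rewrite !isg_assoc -(isg_assoc e f f) ff -(isg_assoc _ e e) ee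
            -isg_assoc K.
  rewrite !isg_assoc -(isg_assoc _ e e) ee -(isg_assoc _ f f) ff.
  by rewrite -[in RHS]V !isg_assoc.
have gg : g * g = g.
  rewrite -{1}fge -{2}fge !isg_assoc -(isg_assoc _ e f).
  rewrite -(isg_assoc f g) -(isg_assoc f _ g) V.
  exact: fge.
have -> // : e * f = g.
by rewrite -(isg_idem_inv gg); apply: isg_uniq; rewrite ?V ?K.
Qed.

Lemma isg_idem_comm (e f : S) : e * e = e -> f * f = f -> e * f = f * e.
Proof.
move=> ee ff; have efi := isg_idem_mul ee ff; have fei := isg_idem_mul ff ee.
rewrite -[LHS](isg_idem_inv efi); symmetry; apply: isg_uniq.
  rewrite !isg_assoc -(isg_assoc e f f) ff -(isg_assoc _ e e) ee -isg_assoc.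
  exact: efi.
rewrite !isg_assoc -(isg_assoc f e e) ee -(isg_assoc _ f f) ff -isg_assoc.
exact: fei.
Qed.

Lemma isg_mulV_idem (s : S) : (s * s^-1) * (s * s^-1) = s * s^-1.
Proof. by rewrite isg_assoc isg_invK. Qed.

Lemma isg_Vmul_idem (s : S) : (s^-1 * s) * (s^-1 * s) = s^-1 * s.
Proof. by rewrite isg_assoc isg_invV. Qed.

Lemma isg_invM (s t : S) : (s * t)^-1 = t^-1 * s^-1.
Proof.
have comm := isg_idem_comm (isg_mulV_idem t) (isg_Vmul_idem s).
symmetry; apply: isg_uniq.
  transitivity (s * ((t * t^-1) * (s^-1 * s)) * t); first by rewrite !isg_assoc.
  by rewrite comm !isg_assoc isg_invK -!isg_assoc (isg_assoc t) isg_invK.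
transitivity (t^-1 * ((s^-1 * s) * (t * t^-1)) * s^-1);
  first by rewrite !isg_assoc.
by rewrite -comm !isg_assoc isg_invV -!isg_assoc (isg_assoc _ s) isg_invV.
Qed.

Lemma isg_invI (s : S) : (s^-1)^-1 = s.
Proof. by symmetry; apply: isg_uniq; rewrite ?isg_invK ?isg_invV. Qed.

End InverseSemigroupTheory.

Section HeapOfBimodule.
Context (S T : inverse_semigroup) (X : Type).
Context (B : equivalence_bimodule S T X).

Definition bim_op (x y z : X) : X := lact B (lform B x y) z.

Lemma bim_A1 x : bim_op x x x = x.
Proof. exact: lform_id. Qed.

Lemma bim_assoc x1 x2 x3 x4 x5 :
  bim_op (bim_op x1 x2 x3) x4 x5 = bim_op x1 x2 (bim_op x3 x4 x5).
Proof. by rewrite /bim_op lformM lactM. Qed.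

Lemma bim_A2r x1 x2 x3 x4 x5 :
  bim_op x1 (bim_op x4 x3 x2) x5 = bim_op x1 x2 (bim_op x3 x4 x5).
Proof.
rewrite /bim_op (lformV B (lact B _ _)) lformM isg_invM lactM.
by rewrite -!lformV.
Qed.

Lemma bim_A2l x1 x2 x3 x4 x5 :
  bim_op (bim_op x1 x2 x3) x4 x5 = bim_op x1 (bim_op x4 x3 x2) x5.
Proof. by rewrite bim_assoc bim_A2r. Qed.

Lemma bim_A3 x y z : bim_op x x (bim_op y y z) = bim_op y y (bim_op x x z).
Proof.
have idem w : isg_mul (lform B w w) (lform B w w) = lform B w w.
  by rewrite -lformM lform_id.
by rewrite /bim_op -!lactM (isg_idem_comm (idem x) (idem y)).
Qed.

Lemma bim_A4 x y z : bim_op (bim_op z x x) y y = bim_op (bim_op z y y) x x.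
Proof.
have idem w : isg_mul (rform B w w) (rform B w w) = rform B w w.
  by rewrite -rformM rform_id.
by rewrite /bim_op !form_assoc -!ractM (isg_idem_comm (idem x) (idem y)).
Qed.

Definition heap_of_bimodule : gheap X :=
  GHeap bim_A1 bim_A2l bim_A2r bim_A3 bim_A4.

End HeapOfBimodule.

(** * Quotients, as sets of equivalence classes *)

Definition is_equiv (T : Type) (R : T -> T -> Prop) : Prop :=
  [/\ forall x, R x x, forall x y, R x y -> R y x &
      forall x y z, R x y -> R y z -> R x z].

Definition quotient (T : Type) (R : T -> T -> Prop) : Type :=
  {A : T -> Prop | exists x, A = R x}.

Definition quot_pi (T : Type) (R : T -> T -> Prop) (x : T) : quotient R :=
  exist _ (R x) (ex_intro _ x eq_refl).

Definition quot_repr (T : Type) (R : T -> T -> Prop) (c : quotient R) : T :=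
  proj1_sig (constructive_indefinite_description _ (proj2_sig c)).

Lemma quot_reprK (T : Type) (R : T -> T -> Prop) (c : quotient R) :
  quot_pi R (quot_repr c) = c.
Proof.
rewrite /quot_repr; case: (constructive_indefinite_description _ _) => x /= cE.
by case: c cE => A iA /= AE; apply: subset_eq_compat.
Qed.

Lemma quot_piP (T : Type) (R : T -> T -> Prop) : is_equiv R ->
  forall x y, quot_pi R x = quot_pi R y <-> R x y.
Proof.
move=> [Rr Rs Rt] x y; split=> [[E]|Rxy]; first by rewrite E.
have E : R x = R y.
  apply: functional_extensionality => z; apply: propositional_extensionality.
  by split; apply: Rt => //; apply: Rs.
exact: subset_eq_compat.
Qed.

Lemma quot_reprP (T : Type) (R : T -> T -> Prop) : is_equiv R ->
  forall x, R (quot_repr (quot_pi R x)) x.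
Proof. by move=> eR x; apply/(quot_piP eR); apply: quot_reprK. Qed.

(** * Green's relations: equality of the principal ideals x S^1, resp. S^1 x *)

Definition greenR (T : Type) (op : T -> T -> T) (x y : T) : Prop :=
  forall z, (z = x \/ exists s, z = op x s) <-> (z = y \/ exists s, z = op y s).

Definition greenL (T : Type) (op : T -> T -> T) (x y : T) : Prop :=
  forall z, (z = x \/ exists s, z = op s x) <-> (z = y \/ exists s, z = op s y).

Lemma greenR_equiv (T : Type) (op : T -> T -> T) : is_equiv (greenR op).
Proof.
split=> [x z|x y xy z|x y t xy yt z] //; first by split=> /xy.
by split=> [/xy/yt|/yt/xy].
Qed.

Lemma greenL_equiv (T : Type) (op : T -> T -> T) : is_equiv (greenL op).
Proof. exact: (greenR_equiv (fun x y => op y x)). Qed.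

Section HeapTheory.
Context (X : Type).
Implicit Types (h : gheap X).

Definition circ h (x y : X) : X := h x x y.
Definition bullet h (x y : X) : X := h x y y.

(** E = (X, circ) / R and F = (X, bullet) / L with their natural maps; only
    equality of images is used, see [pP] and [qP]. *)
Definition heapE h : Type := quotient (greenR (circ h)).
Definition heapF h : Type := quotient (greenL (bullet h)).
Definition p h (x : X) : heapE h := quot_pi _ x.
Definition q h (x : X) : heapF h := quot_pi _ x.

Lemma heap_A2 h x1 x2 x3 x4 x5 :
  h (h x1 x2 x3) x4 x5 = h x1 x2 (h x3 x4 x5).
Proof. by rewrite heap_A2l heap_A2r. Qed.

(** The opposite heap: it exchanges [p] and [q]. *)
Definition mirror h : gheap X.
Proof.
refine (@GHeap X (fun x y z => h z y x) _ _ _ _ _).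
- exact: heap_A1.
- by move=> *; rewrite heap_A2r.
- by move=> *; rewrite heap_A2l.
- by move=> *; rewrite heap_A4.
- by move=> *; rewrite heap_A3.
Defined.

Lemma greenR_circP h x y :
  greenR (circ h) x y <-> x = h y y x /\ y = h x x y.
Proof.
have mem a b : (a = b \/ exists s, a = circ h b s) -> a = h b b a.
  by rewrite /circ => -[->|[s ->]]; rewrite -?heap_A2 heap_A1.
have sub a b z : a = h b b a -> (z = a \/ exists s, z = circ h a s) ->
    z = b \/ exists s, z = circ h b s.
  rewrite /circ => ab [->|[s ->]]; right; first by exists a.
  by exists (h a a s); rewrite -heap_A2 -ab.
split=> [xy|[xy yx] z]; last by split; apply: sub.
by split; apply: mem; apply/xy; left.
Qed.

Lemma pP h x y : p h x = p h y <-> x = h y y x /\ y = h x x y.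
Proof.
rewrite -greenR_circP; exact: (quot_piP (greenR_equiv _)).
Qed.

Lemma qP h x y : q h x = q h y <-> x = h x y y /\ y = h y x x.
Proof.
have := greenR_circP (mirror h) x y => /= <-.
exact: (quot_piP (greenL_equiv _)).
Qed.

Lemma p_actP h x y : p h x = p h y <-> forall z, h x x z = h y y z.
Proof.
rewrite pP; split=> [[xy yx] z|E]; last first.
  by split; rewrite ?E ?heap_A1 // -E heap_A1.
have -> : h x x z = h y y (h x x z) by rewrite -heap_A2 -xy.
by rewrite heap_A3 -heap_A2 -yx.
Qed.

Lemma q_actP h x y : q h x = q h y <-> forall z, h z x x = h z y y.
Proof. by rewrite qP -(pP (mirror h)) p_actP. Qed.

Section Core.
Context (h : gheap X) (x y u v : X).
Context (qxy : forall z, h z x x = h z y y).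
Context (quv : forall z, h z u u = h z v v).

Lemma core_eqv :
  (forall z, h x x z = h u u z) /\ (forall z, h y y z = h v v z) /\
    x = h u v y
  <-> forall z, h x y z = h u v z.
Proof.
have xyy : h x y y = x by rewrite -qxy heap_A1.
have yxx : h y x x = y by rewrite qxy heap_A1.
have uvv : h u v v = u by rewrite -quv heap_A1.
split=> [[_ [yv xE]] z|E].
  by rewrite xE heap_A2 yv -heap_A2 uvv.
have vuu : h v u u = v by rewrite quv heap_A1.
split; [|split; last by rewrite -E xyy].
- move=> z.
  have Ex w : h x x w = h u v (h y x w) by rewrite -E -heap_A2 xyy.
  have Eu w : h u u w = h x y (h v u w) by rewrite E -heap_A2 uvv.
  transitivity (h u u (h x x z)); first by rewrite Ex -(heap_A2 h u u) heap_A1.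
  by rewrite heap_A3 Eu -(heap_A2 h x x) heap_A1.
- move=> z.
  have Ey w : h y y w = h y x (h u v w) by rewrite -E -heap_A2 yxx.
  have Ev w : h v v w = h v u (h x y w) by rewrite E -heap_A2 vuu.
  transitivity (h y y (h v v z)).
    by rewrite !Ey -(heap_A2 h u v v) uvv.
  by rewrite heap_A3 !Ev -(heap_A2 h x y y) xyy.
Qed.

Lemma core_mul_q z :
  h z (h x y u) (h x y u) = h z (h v u (h y y u)) (h v u (h y y u)).
Proof.
have yxx : h y x x = y by rewrite qxy heap_A1.
have uvv : h u v v = u by rewrite -quv heap_A1.
rewrite (heap_A2r h z u) -(heap_A2 h y x x) yxx.
rewrite (heap_A2r h z (h y y u)) -(heap_A2 h u v v) uvv.
rewrite (heap_A3 h u y) heap_A1 (heap_A2r h z u).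
by rewrite -(heap_A2 h y y y) heap_A1.
Qed.

End Core.

Lemma absorb h x y z : h x y (h y y z) = h x y z.
Proof. by rewrite -(heap_A2 h x y y) heap_A2l heap_A1. Qed.

Lemma core_mul h x y u v z :
  h (h x y u) (h v u (h y y u)) z = h x y (h u v z).
Proof.
rewrite (heap_A2r h _ _ u v) (heap_A2r h _ u y y) (heap_A2 h x y u).
by rewrite heap_A3 absorb -(heap_A2 h u u u) heap_A1.
Qed.

Lemma core_mul_inv h x y u v z :
  h (h v u (h y y u)) (h x y u) z = h v u (h y x z).
Proof.
rewrite (heap_A2r h _ u y x) (heap_A2 h v u) (heap_A2 h y y u).
by rewrite heap_A3 absorb -(heap_A2 h y y y) heap_A1.
Qed.

Lemma core_form h x y z : h (h x y y) (h y x x) z = h x y z.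
Proof.
rewrite (heap_A2r h _ x x y) -(heap_A2 h (h x y y) x x).
by rewrite (heap_A4 h y x) heap_A1 (heap_A2l h x y y) heap_A1.
Qed.

Lemma core_form_q h x y z :
  h z (h x y y) (h x y y) = h z (h y x x) (h y x x).
Proof.
have half a b : h z (h a b b) (h a b b) = h (h z b b) a a.
  rewrite (heap_A2r h z b) -(heap_A2 h b a a) (heap_A4 h a b) heap_A1.
  by rewrite (heap_A2 h z b b).
by rewrite !half heap_A4.
Qed.

End HeapTheory.

(** A semigroup with a regular involution whose projections commute is inverse. *)
Lemma star_inverse (S : Type) (m : S -> S -> S) (i : S -> S) :
  (forall r s t, m r (m s t) = m (m r s) t) ->
  (forall s, m (m s (i s)) s = s) -> (forall s, i (i s) = s) ->
  (forall s t, i (m s t) = m (i t) (i s)) ->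
  (forall s t, m (m s (i s)) (m t (i t)) = m (m t (i t)) (m s (i s))) ->
  forall s t, m (m s t) s = s -> m (m t s) t = t -> t = i s.
Proof.
move=> mA iK iI iM proj.
have iV s : m (m (i s) s) (i s) = i s by rewrite -{2}(iI s) iK.
have self e : m e e = e -> e = m e (i e).
  move=> ee; have ii : m (i e) (i e) = i e by rewrite -iM ee.
  suff eE : e = i e by rewrite -eE ee.
  transitivity (m (m e (i e)) (m (i e) (i (i e)))).
    by rewrite iI mA -(mA e (i e) (i e)) ii iK.
  by rewrite proj iI mA -(mA (i e) e e) ee iV.
have comm e f : m e e = e -> m f f = f -> m e f = m f e.
  by move=> /self-> /self->; apply: proj.
have uniq s a b : m (m s a) s = s -> m (m a s) a = a ->
    m (m s b) s = s -> m (m b s) b = b -> a = b.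
  move=> sa as_ sb bs.
  have [sa2 sb2] : m (m s a) (m s a) = m s a /\ m (m s b) (m s b) = m s b.
    by rewrite !mA sa sb.
  have [as2 bs2] : m (m a s) (m a s) = m a s /\ m (m b s) (m b s) = m b s.
    by rewrite !mA as_ bs.
  have sab : m s a = m s b.
    transitivity (m (m s b) (m s a)); first by rewrite mA sb.
    by rewrite (comm _ _ sb2 sa2) mA sa.
  have abs : m a s = m b s.
    transitivity (m (m a s) (m b s)); first by rewrite -mA (mA s) sb.
    by rewrite (comm _ _ as2 bs2) -mA (mA s) sa.
  by rewrite -as_ -mA sab mA abs bs.
by move=> s t st ts; apply: (uniq s).
Qed.

(** * The inverse semigroup X X^-1 *)

Section XXinv.
Context (X : Type) (h : gheap X).

Definition qpair : Type := {xy : X * X | q h xy.1 = q h xy.2}.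

Definition qpair_of x y (e : q h x = q h y) : qpair := exist _ (x, y) e.

Definition qpair_eqv (a b : qpair) : Prop :=
  let (x, y) := proj1_sig a in let (u, v) := proj1_sig b in
  p h x = p h u /\ p h y = p h v /\ x = h u v y.

Definition XXinv_type : Type := quotient qpair_eqv.

(** [rfrac e] is x y^-1, for [e : q x = q y]. *)
Definition rfrac x y (e : q h x = q h y) : XXinv_type :=
  quot_pi qpair_eqv (qpair_of e).

Definition rnum (c : XXinv_type) : X := (proj1_sig (quot_repr c)).1.
Definition rden (c : XXinv_type) : X := (proj1_sig (quot_repr c)).2.
Definition rnum_den (c : XXinv_type) : q h (rnum c) = q h (rden c) :=
  proj2_sig (quot_repr c).

Lemma rmul_q x y u v : q h x = q h y -> q h u = q h v ->
  q h (h x y u) = q h (h v u (h y y u)).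
Proof. by rewrite !q_actP => xy uv z; apply: core_mul_q. Qed.

Lemma rform_q x y : q h (h x y y) = q h (h y x x).
Proof. by apply/q_actP => z; apply: core_form_q. Qed.

(** Computed on representatives; see [rmulE] and [rapplyE]. *)
Definition rmul (c d : XXinv_type) : XXinv_type :=
  rfrac (rmul_q (rnum_den c) (rnum_den d)).
Definition rinv (c : XXinv_type) : XXinv_type := rfrac (esym (rnum_den c)).
Definition rapply (c : XXinv_type) (z : X) : X := h (rnum c) (rden c) z.

Definition XXform (x y : X) : XXinv_type := rfrac (rform_q x y).

Lemma qpair_eqvP (a b : qpair) :
  qpair_eqv a b <-> forall z,
    h (proj1_sig a).1 (proj1_sig a).2 z = h (proj1_sig b).1 (proj1_sig b).2 z.
Proof.
rewrite /qpair_eqv; case: a => -[x y] /= e; case: b => -[u v] /= f.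
move/q_actP: (e) => xy; move/q_actP: (f) => uv.
by rewrite -(core_eqv xy uv) !p_actP.
Qed.

Lemma qpair_equiv : is_equiv qpair_eqv.
Proof.
split=> [a|a b /qpair_eqvP ab|a b c /qpair_eqvP ab /qpair_eqvP bc];
  by apply/qpair_eqvP => z; rewrite ?ab ?bc.
Qed.

Lemma rapplyE x y (e : q h x = q h y) z : rapply (rfrac e) z = h x y z.
Proof. by have /qpair_eqvP/(_ z) := quot_reprP qpair_equiv (qpair_of e). Qed.

Lemma rfracK (c : XXinv_type) : rfrac (rnum_den c) = c.
Proof.
rewrite -[RHS]quot_reprK /rfrac; apply/(quot_piP qpair_equiv)/qpair_eqvP => z.
by [].
Qed.

Lemma rapply_inj (c d : XXinv_type) :
  (forall z, rapply c z = rapply d z) -> c = d.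
Proof.
by rewrite -(rfracK c) -(rfracK d) => E;
   apply/(quot_piP qpair_equiv)/qpair_eqvP => z /=; have := E z; rewrite !rapplyE.
Qed.

Lemma rapplyM c d z : rapply (rmul c d) z = rapply c (rapply d z).
Proof. by rewrite rapplyE core_mul. Qed.

Lemma rmulE x y u v (e : q h x = q h y) (f : q h u = q h v) :
  rmul (rfrac e) (rfrac f) = rfrac (rmul_q e f).
Proof. by apply: rapply_inj => z; rewrite rapplyM !rapplyE core_mul. Qed.

Lemma rinvE x y (e : q h x = q h y) : rinv (rfrac e) = rfrac (esym e).
Proof.
have := rfracK (rfrac e); rewrite /rinv.
move: (rnum _) (rden _) (rnum_den _) => u v f.
move=> /(quot_piP qpair_equiv) [/= ux [vy uE]].
apply/(quot_piP qpair_equiv); split=> //=; split=> //.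
move/qP: e => [_ yxx]; move/p_actP: vy => vy.
by rewrite uE -(heap_A2 h y x x) -yxx -vy heap_A1.
Qed.

Lemma rmulA c d e : rmul c (rmul d e) = rmul (rmul c d) e.
Proof. by apply: rapply_inj => z; rewrite !rapplyM. Qed.

Lemma rinvK c : rmul (rmul c (rinv c)) c = c.
Proof.
apply: rapply_inj => z; rewrite -(rfracK c); move: (rnum_den c) => e.
rewrite !rapplyM rinvE !rapplyE -(heap_A2 h (rden c)).
by have /qP [_ <-] := e; rewrite absorb.
Qed.

Lemma rinvI c : rinv (rinv c) = c.
Proof. by rewrite -(rfracK c) !rinvE; apply: rapply_inj => z; rewrite !rapplyE. Qed.

Lemma rinvV c : rmul (rmul (rinv c) c) (rinv c) = rinv c.
Proof. by rewrite -{2}(rinvI c) rinvK. Qed.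

Lemma rinvM c d : rinv (rmul c d) = rmul (rinv d) (rinv c).
Proof.
apply: rapply_inj => z; rewrite -(rfracK c) -(rfracK d).
move: (rnum_den c) (rnum_den d) => e f.
by rewrite rmulE rapplyM !rinvE !rapplyE core_mul_inv.
Qed.

Lemma rproj_comm c d :
  rmul (rmul c (rinv c)) (rmul d (rinv d)) =
  rmul (rmul d (rinv d)) (rmul c (rinv c)).
Proof.
have proj (k : XXinv_type) z : rapply (rmul k (rinv k)) z = h (rnum k) (rnum k) z.
  rewrite -{1 2}(rfracK k); move: (rnum_den k) => e.
  rewrite !rapplyM rinvE !rapplyE -heap_A2.
  by move/q_actP: e => <-; rewrite heap_A1.
by apply: rapply_inj => z; rewrite rapplyM !proj heap_A3 -!proj -rapplyM.
Qed.

Definition XXinv : inverse_semigroup :=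
  InverseSemigroup rmulA rinvK rinvV
    (star_inverse rmulA rinvK rinvI rinvM rproj_comm).

Lemma rapply_unitary x : exists (s : XXinv) y, rapply s y = x.
Proof. by exists (@rfrac x x erefl), x; rewrite rapplyE heap_A1. Qed.

Definition XX_left_module : left_module XXinv X :=
  @LeftModule XXinv X rapply rapplyM rapply_unitary.

Lemma XXform_applyE x y z : rapply (XXform x y) z = h x y z.
Proof. by rewrite rapplyE core_form. Qed.

Lemma XXform_surj (c : XXinv_type) : exists x y, XXform x y = c.
Proof.
exists (rnum c), (rden c); apply: rapply_inj => z.
by rewrite XXform_applyE.
Qed.

Lemma XXformM c x y : XXform (rapply c x) y = rmul c (XXform x y).
Proof.
by apply: rapply_inj => z; rewrite rapplyM !XXform_applyE /rapply heap_A2.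
Qed.

Lemma XXformV x y : XXform y x = rinv (XXform x y).
Proof. by rewrite rinvE; apply: rapply_inj => z; rewrite !rapplyE. Qed.

End XXinv.

(** * The inverse semigroup X^-1 X *)

Section XinvX.
Context (X : Type) (h : gheap X).

Definition ppair : Type := {xy : X * X | p h xy.1 = p h xy.2}.

Definition ppair_of x y (e : p h x = p h y) : ppair := exist _ (x, y) e.

Definition ppair_eqv (a b : ppair) : Prop :=
  let (x, y) := proj1_sig a in let (u, v) := proj1_sig b in
  q h x = q h u /\ q h y = q h v /\ y = h x u v.

Definition XinvX_type : Type := quotient ppair_eqv.

(** [lfrac e] is x^-1 y, for [e : p x = p y]. *)
Definition lfrac x y (e : p h x = p h y) : XinvX_type :=
  quot_pi ppair_eqv (ppair_of e).

Definition lden (c : XinvX_type) : X := (proj1_sig (quot_repr c)).1.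
Definition lnum (c : XinvX_type) : X := (proj1_sig (quot_repr c)).2.
Definition lden_num (c : XinvX_type) : p h (lden c) = p h (lnum c) :=
  proj2_sig (quot_repr c).

Lemma lmul_p x y u v : p h x = p h y -> p h u = p h v ->
  p h (h (h y u u) y x) = p h (h y u v).
Proof.
rewrite !p_actP => xy uv z; symmetry.
by apply: (@core_mul_q _ (mirror h) v u y x) => w /=.
Qed.

Lemma lform_p x y : p h (h y y x) = p h (h x x y).
Proof. by apply/p_actP => z; apply: (core_form_q (mirror h)). Qed.

(** Computed on representatives; see [lmulE] and [lapplyE]. *)
Definition lmul (c d : XinvX_type) : XinvX_type :=
  lfrac (lmul_p (lden_num c) (lden_num d)).
Definition linv (c : XinvX_type) : XinvX_type := lfrac (esym (lden_num c)).
Definition lapply (z : X) (c : XinvX_type) : X := h z (lden c) (lnum c).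

Definition XVform (x y : X) : XinvX_type := lfrac (lform_p x y).

Lemma ppair_eqvP (a b : ppair) :
  ppair_eqv a b <-> forall z,
    h z (proj1_sig a).1 (proj1_sig a).2 = h z (proj1_sig b).1 (proj1_sig b).2.
Proof.
rewrite /ppair_eqv; case: a => -[x y] /= e; case: b => -[u v] /= f.
have yx z : mirror h z y y = mirror h z x x by move/p_actP: (e) => /= ->.
have vu z : mirror h z v v = mirror h z u u by move/p_actP: (f) => /= ->.
by have := core_eqv yx vu => /= <-; rewrite !q_actP; tauto.
Qed.

Lemma ppair_equiv : is_equiv ppair_eqv.
Proof.
split=> [a|a b /ppair_eqvP ab|a b c /ppair_eqvP ab /ppair_eqvP bc];
  by apply/ppair_eqvP => z; rewrite ?ab ?bc.
Qed.

Lemma lapplyE x y (e : p h x = p h y) z : lapply z (lfrac e) = h z x y.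
Proof. by have /ppair_eqvP/(_ z) := quot_reprP ppair_equiv (ppair_of e). Qed.

Lemma lfracK (c : XinvX_type) : lfrac (lden_num c) = c.
Proof.
rewrite -[RHS]quot_reprK /lfrac; apply/(quot_piP ppair_equiv)/ppair_eqvP => z.
by [].
Qed.

Lemma lapply_inj (c d : XinvX_type) :
  (forall z, lapply z c = lapply z d) -> c = d.
Proof.
by rewrite -(lfracK c) -(lfracK d) => E;
   apply/(quot_piP ppair_equiv)/ppair_eqvP => z /=; have := E z; rewrite !lapplyE.
Qed.

Lemma lapplyM c d z : lapply z (lmul c d) = lapply (lapply z c) d.
Proof. by rewrite lapplyE; apply: (core_mul (mirror h)). Qed.

Lemma lmulE x y u v (e : p h x = p h y) (f : p h u = p h v) :
  lmul (lfrac e) (lfrac f) = lfrac (lmul_p e f).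
Proof.
apply: lapply_inj => z; rewrite lapplyM !lapplyE; symmetry.
exact: (core_mul (mirror h)).
Qed.

Lemma linvE x y (e : p h x = p h y) : linv (lfrac e) = lfrac (esym e).
Proof.
have := lfracK (lfrac e); rewrite /linv.
move: (lden _) (lnum _) (lden_num _) => u v f.
move=> /(quot_piP ppair_equiv) [/= ux [vy vE]].
apply/(quot_piP ppair_equiv); split=> //=; split=> //.
move/pP: e => [xE _]; move/q_actP: ux => ux.
by rewrite vE (heap_A2 h u) -xE -ux heap_A1.
Qed.

Lemma lmulA c d e : lmul c (lmul d e) = lmul (lmul c d) e.
Proof. by apply: lapply_inj => z; rewrite !lapplyM. Qed.

Lemma linvK c : lmul (lmul c (linv c)) c = c.
Proof.
apply: lapply_inj => z; rewrite -(lfracK c); move: (lden_num c) => e.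
rewrite !lapplyM linvE !lapplyE (heap_A2 h z).
by have /pP [<- _] := e; rewrite heap_A2 absorb.
Qed.

Lemma linvI c : linv (linv c) = c.
Proof. by rewrite -(lfracK c) !linvE; apply: lapply_inj => z; rewrite !lapplyE. Qed.

Lemma linvV c : lmul (lmul (linv c) c) (linv c) = linv c.
Proof. by rewrite -{2}(linvI c) linvK. Qed.

Lemma linvM c d : linv (lmul c d) = lmul (linv d) (linv c).
Proof.
apply: lapply_inj => z; rewrite -(lfracK c) -(lfracK d).
move: (lden_num c) (lden_num d) => e f.
rewrite lmulE lapplyM !linvE !lapplyE.
exact: (core_mul_inv (mirror h)).
Qed.

Lemma lproj_comm c d :
  lmul (lmul c (linv c)) (lmul d (linv d)) =
  lmul (lmul d (linv d)) (lmul c (linv c)).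
Proof.
have proj (k : XinvX_type) z : lapply z (lmul k (linv k)) = h z (lden k) (lden k).
  rewrite -{1 2}(lfracK k); move: (lden_num k) => e.
  rewrite !lapplyM linvE !lapplyE heap_A2.
  by move/pP: e => [<- _].
by apply: lapply_inj => z; rewrite lapplyM !proj heap_A4 -!proj -lapplyM.
Qed.

Definition XinvX : inverse_semigroup :=
  InverseSemigroup lmulA linvK linvV
    (star_inverse lmulA linvK linvI linvM lproj_comm).

Lemma lapply_unitary x : exists y (t : XinvX), lapply y t = x.
Proof. by exists x, (@lfrac x x erefl); rewrite lapplyE heap_A1. Qed.

Definition XX_right_module : right_module XinvX X :=
  @RightModule XinvX X lapply lapplyM lapply_unitary.

Lemma XVform_applyE x y z : lapply z (XVform x y) = h z x y.
Proof. by rewrite lapplyE; apply: (core_form (mirror h)). Qed.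

Lemma XVform_surj (c : XinvX_type) : exists x y, XVform x y = c.
Proof.
exists (lden c), (lnum c); apply: lapply_inj => z.
by rewrite XVform_applyE.
Qed.

Lemma XVformM x y c : XVform x (lapply y c) = lmul (XVform x y) c.
Proof.
by apply: lapply_inj => z; rewrite lapplyM !XVform_applyE /lapply heap_A2.
Qed.

Lemma XVformV x y : XVform x y = linv (XVform y x).
Proof. by rewrite linvE; apply: lapply_inj => z; rewrite !lapplyE. Qed.

End XinvX.

(** * The equivalence bimodule constructed from a generalized heap *)

Section BimoduleOfHeap.
Context (X : Type) (h : gheap X).

Lemma heap_bim_comm (s : XXinv h) (x : X) (t : XinvX h) :
  lapply (rapply s x) t = rapply s (lapply x t).
Proof. exact: heap_A2. Qed.

Definition heap_bimodule : bimodule (XXinv h) (XinvX h) X :=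
  @Bimodule (XXinv h) (XinvX h) X (XX_left_module h) (XX_right_module h)
    heap_bim_comm.

Lemma XXform_id x : rapply (XXform h x x) x = x.
Proof. by rewrite XXform_applyE heap_A1. Qed.

Lemma XVform_id x : lapply x (XVform h x x) = x.
Proof. by rewrite XVform_applyE heap_A1. Qed.

Lemma forms_assoc x y z : rapply (XXform h x y) z = lapply x (XVform h y z).
Proof. by rewrite XXform_applyE XVform_applyE. Qed.

Definition bimodule_of_heap : equivalence_bimodule (XXinv h) (XinvX h) X :=
  @EquivalenceBimodule (XXinv h) (XinvX h) X heap_bimodule
    (XXform h) (XVform h) (@XXform_surj X h) (@XVform_surj X h)
    (@XXformM X h) (@XXformV X h) XXform_id
    (@XVformM X h) (@XVformV X h) XVform_id forms_assoc.

End BimoduleOfHeap.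

(* Main.v *)
From Corelib Require Import ssreflect ssrfun ssrbool.
From Stdlib Require Import FunctionalExtensionality ProofIrrelevance.
Require Import Defs.

(** The class of a pair (u,v) acts by z |-> {uvz}, independently of the chosen
    representative, so <x,y> z = {{xyy}{yxx}z}. By (A2) this is
    {{{xyy}xx}yz}; (A4) interchanges the right multiplications by yy and xx and
    turns it into {{{xxx}yy}yz} = {{xyy}yz} = {x{yyy}z} = {xyz}, which is the
    content of [core_form] and [XXform_applyE]. A generalized heap is its
    ternary operation together with proofs of the axioms, so the pointwise
    identity upgrades to an equality of heaps by [gheap_ext]. *)

(** The axioms are propositions, so by proof irrelevance only the operation
    distinguishes two heaps on the same set. *)
Lemma gheap_ext (X : Type) (g h : gheap X) :
  (forall x y z, g x y z = h x y z) -> g = h.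
Proof.
case: g h => [g a1 a2 a3 a4 a5] [h b1 b2 b3 b4 b5] /= gh.
have E : g = h.
  by do 3!(apply: functional_extensionality => ?); apply: gh.
case: h / E b1 b2 b3 b4 b5 {gh} => b1 b2 b3 b4 b5.
by f_equal; apply: proof_irrelevance.
Qed.

Theorem mainTheorem4 (X : Type) (h : gheap X) :
  heap_of_bimodule (bimodule_of_heap h) = h /\
  forall x y z : X,
    lact (bimodule_of_heap h) (lform (bimodule_of_heap h) x y) z = h x y z.
Proof.
have E x y z :
    lact (bimodule_of_heap h) (lform (bimodule_of_heap h) x y) z = h x y z.
  exact: XXform_applyE.
by split=> //; apply: gheap_ext.
Qed.
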